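(* Let $\mathcal{M}_c$ be the free symmetric monoidal category with a family of linear endofunctors $\{E^i\mid i\in\mathcal{I}\}$ generated by a set of generating objects. Then the functor $G$ from $\mathcal{M}_c$ to the category $\mathit{Fun}$ of functions between finite ordinals is faithful; i.e. for all arrows $f,g:A\to B$ of $\mathcal{M}_c$, if $Gf=Gg$, then $f=g$ in $\mathcal{M}_c$.
   Context: A symmetric monoidal category has a bifunctor $\otimes$, a unit object $I$, and natural isomorphisms with components $a_{A,B,C}:(A\otimes B)\otimes C\to A\otimes(B\otimes C)$, $l_A:I\otimes A\to A$, $r_A:A\otimes I\to A$, $c_{A,B}:A\otimes B\to B\otimes A$, satisfying Mac Lane's coherence conditions for symmetric monoidal categories (pentagon, triangle, hexagon, $c_{B,A}\circ c_{A,B}=\mathbf{1}_{A\otimes B}$). A linear endofunctor of a symmetric monoidal category is an endofunctor $E$ together with a natural transformation $\psi_{A,B}:EA\otimes EB\to E(A\otimes B)$ and an arrow $\psi_0:I\to EI$ (not assumed to be isomorphisms) such that (1) $Ea_{A,B,C}\circ\psi_{A\otimes B,C}\circ(\psi_{A,B}\otimes\mathbf{1}_{EC})=\psi_{A,B\otimes C}\circ(\mathbf{1}_{EA}\otimes\psi_{B,C})\circ a_{EA,EB,EC}$; (2) $El_A\circ\psi_{I,A}\circ(\psi_0\otimes\mathbf{1}_{EA})=l_{EA}$; (3) $Er_A\circ\psi_{A,I}\circ(\mathbf{1}_{EA}\otimes\psi_0)=r_{EA}$; (4) $Ec_{A,B}\circ\psi_{A,B}=\psi_{B,A}\circ c_{EA,EB}$.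 The category $\mathcal{M}_c$: fix two arbitrary sets, one of generating objects (propositional letters) and one of generating functors $\{E^i\mid i\in\mathcal{I}\}$; together these are the generators. Objects are the formulae built from the letters and the constant $I$ with the binary connective $\otimes$ and the unary connectives $E^i$. Arrows are equivalence classes of arrow terms built from $\mathbf{1}_A$, $a_{A,B,C}$, $l_A$, $r_A$, their inverses, $c_{A,B}$, and $\psi^i_{A,B}$, $\psi^i_0$ (for each $i\in\mathcal{I}$) with the operations $\circ$, $\otimes$ and $E^i$, modulo the smallest congruence for which the equations of symmetric monoidal categories hold and each $(E^i,\psi^i,\psi^i_0)$ is a linear endofunctor. Superscripts $i$ are omitted below. The functor $G$: $\mathit{Fun}$ has as objects the finite ordinals $n=\{0,\dots,n-1\}$ and as arrows all functions. $GA$ is the number of occurrences of generators (letters and functors $E^i$) in $A$, numbered $0,1,\dots$ from left to right. $G$ of $\mathbf{1}$, $a$, $l$, $r$ (and inverses) is an identity function; $Gc_{A,B}$ maps $k\mapsto GB+k$ for $k<GA$ and $GA+k\mapsto k$ for $k<GB$; $G\psi_{A,B}:1+GA+1+GB\to 1+GA+GB$ maps $0\mapsto 0$, $1+k\mapsto 1+k$ for $k<GA$, $GA+1\mapsto 0$, and $GA+2+k\mapsto 1+GA+k$ for $k<GB$; $G\psi_0$ is the empty function from $0$ to $1$; $G(f\otimes g)$ is $Gf$ and $Gg$ placed side by side (disjoint sum); $GEf$ maps $0\mapsto 0$ and $1+k\mapsto 1+(Gf)(k)$; $G(g\circ f)=Gg\circ Gf$. *)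

(* Defs.v *)
From mathcomp Require Import all_boot.

Set Implicit Arguments.
Unset Strict Implicit.
Unset Printing Implicit Defensive.

Declare Scope obj_scope.
Delimit Scope obj_scope with obj.
Declare Scope arr_scope.
Delimit Scope arr_scope with arr.

Reserved Notation "A ⊗ B" (at level 40, left associativity).
Reserved Notation "g ∘ f" (at level 50, left associativity).
Reserved Notation "f ≈ g" (at level 70, no associativity).

(* Objects of M_c: [P] is the set of letters, [J] the index set of the        *)
(* generating functors E^i.                                                   *)
Inductive obj (P J : Type) : Type :=
| Letter of P
| One
| Tens of obj P J & obj P J
| E of J & obj P J.
Arguments Letter {P J} _.
Arguments One {P J}.
Arguments E {P J} i A.

Bind Scope obj_scope with obj.
Notation "A ⊗ B" := (Tens A B) : obj_scope.

Inductive arr (P J : Type) : obj P J -> obj P J -> Type :=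
| Id A : arr A A
| Assoc A B C : arr ((A ⊗ B) ⊗ C) (A ⊗ (B ⊗ C))
| AssocV A B C : arr (A ⊗ (B ⊗ C)) ((A ⊗ B) ⊗ C)
| Lunit A : arr (One ⊗ A) A
| LunitV A : arr A (One ⊗ A)
| Runit A : arr (A ⊗ One) A
| RunitV A : arr A (A ⊗ One)
| Sym A B : arr (A ⊗ B) (B ⊗ A)
| Psi i A B : arr (E i A ⊗ E i B) (E i (A ⊗ B))
| Psi0 i : arr One (E i One)
| Comp A B C : arr B C -> arr A B -> arr A C
| TensA A B C D : arr A B -> arr C D -> arr (A ⊗ C) (B ⊗ D)
| EA i A B : arr A B -> arr (E i A) (E i B).
Arguments Id {P J} A.
Arguments Assoc {P J} A B C.
Arguments AssocV {P J} A B C.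
Arguments Lunit {P J} A.
Arguments LunitV {P J} A.
Arguments Runit {P J} A.
Arguments RunitV {P J} A.
Arguments Sym {P J} A B.
Arguments Psi {P J} i A B.
Arguments Psi0 {P J} i.
Arguments EA {P J} i {A B} f.

Bind Scope arr_scope with arr.
Notation "g ∘ f" := (Comp g f) : arr_scope.
Notation "f ⊗ g" := (TensA f g) : arr_scope.

(* Arrows of M_c are arrow terms modulo [arr_eq]: "f = g in M_c" is [f ≈ g].  *)
Inductive arr_eq (P J : Type) : forall A B : obj P J, arr A B -> arr A B -> Prop :=
| arr_refl A B (f : arr A B) : f ≈ f
| arr_sym A B (f g : arr A B) : f ≈ g -> g ≈ f
| arr_trans A B (f g h : arr A B) : f ≈ g -> g ≈ h -> f ≈ h
| cong_comp A B C (g g' : arr B C) (f f' : arr A B) :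
    g ≈ g' -> f ≈ f' -> g ∘ f ≈ g' ∘ f'
| cong_tens A B C D (f f' : arr A B) (g g' : arr C D) :
    f ≈ f' -> g ≈ g' -> f ⊗ g ≈ f' ⊗ g'
| cong_E i A B (f f' : arr A B) : f ≈ f' -> EA i f ≈ EA i f'
| comp_idl A B (f : arr A B) : Id B ∘ f ≈ f
| comp_idr A B (f : arr A B) : f ∘ Id A ≈ f
| comp_assoc A B C D (h : arr C D) (g : arr B C) (f : arr A B) :
    h ∘ (g ∘ f) ≈ (h ∘ g) ∘ f
| tens_id A B : Id A ⊗ Id B ≈ Id (A ⊗ B)
| tens_comp A B C A' B' C' (g : arr B C) (f : arr A B)
    (g' : arr B' C') (f' : arr A' B') :
    (g ∘ f) ⊗ (g' ∘ f') ≈ (g ⊗ g') ∘ (f ⊗ f')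
| assoc_nat A B C A' B' C' (f : arr A A') (g : arr B B') (h : arr C C') :
    Assoc A' B' C' ∘ ((f ⊗ g) ⊗ h) ≈ (f ⊗ (g ⊗ h)) ∘ Assoc A B C
| lunit_nat A A' (f : arr A A') : Lunit A' ∘ (Id One ⊗ f) ≈ f ∘ Lunit A
| runit_nat A A' (f : arr A A') : Runit A' ∘ (f ⊗ Id One) ≈ f ∘ Runit A
| sym_nat A B A' B' (f : arr A A') (g : arr B B') :
    Sym A' B' ∘ (f ⊗ g) ≈ (g ⊗ f) ∘ Sym A B
| assocK A B C : AssocV A B C ∘ Assoc A B C ≈ Id ((A ⊗ B) ⊗ C)
| assocVK A B C : Assoc A B C ∘ AssocV A B C ≈ Id (A ⊗ (B ⊗ C))
| lunitK A : LunitV A ∘ Lunit A ≈ Id (One ⊗ A)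
| lunitVK A : Lunit A ∘ LunitV A ≈ Id A
| runitK A : RunitV A ∘ Runit A ≈ Id (A ⊗ One)
| runitVK A : Runit A ∘ RunitV A ≈ Id A
| symK A B : Sym B A ∘ Sym A B ≈ Id (A ⊗ B)
| pentagon A B C D :
    Assoc A B (C ⊗ D) ∘ Assoc (A ⊗ B) C D
    ≈ (Id A ⊗ Assoc B C D) ∘ Assoc A (B ⊗ C) D ∘ (Assoc A B C ⊗ Id D)
| triangle A B : (Id A ⊗ Lunit B) ∘ Assoc A One B ≈ Runit A ⊗ Id B
| hexagon A B C :
    Assoc B C A ∘ Sym A (B ⊗ C) ∘ Assoc A B C
    ≈ (Id B ⊗ Sym A C) ∘ Assoc B A C ∘ (Sym A B ⊗ Id C)
| E_id i A : EA i (Id A) ≈ Id (E i A)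
| E_comp i A B C (g : arr B C) (f : arr A B) : EA i (g ∘ f) ≈ EA i g ∘ EA i f
| psi_nat i A B A' B' (f : arr A A') (g : arr B B') :
    EA i (f ⊗ g) ∘ Psi i A B ≈ Psi i A' B' ∘ (EA i f ⊗ EA i g)
| psi_assoc i A B C :
    EA i (Assoc A B C) ∘ Psi i (A ⊗ B) C ∘ (Psi i A B ⊗ Id (E i C))
    ≈ Psi i A (B ⊗ C) ∘ (Id (E i A) ⊗ Psi i B C) ∘ Assoc (E i A) (E i B) (E i C)
| psi_lunit i A :
    EA i (Lunit A) ∘ Psi i One A ∘ (Psi0 i ⊗ Id (E i A)) ≈ Lunit (E i A)
| psi_runit i A :
    EA i (Runit A) ∘ Psi i A One ∘ (Id (E i A) ⊗ Psi0 i) ≈ Runit (E i A)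
| psi_sym i A B : EA i (Sym A B) ∘ Psi i A B ≈ Psi i B A ∘ Sym (E i A) (E i B)
where "f ≈ g" := (@arr_eq _ _ _ _ f%arr g%arr).

(* Arrows of the category Fun of finite ordinals and functions.               *)
Definition Fun (m n : nat) : Type := {ffun 'I_m -> 'I_n}.

Definition fun_id n : Fun n n := [ffun k => k].

Definition fun_comp m n p (g : Fun n p) (f : Fun m n) : Fun m p :=
  [ffun k => g (f k)].

(* The identity function, when the equality of the ordinals m and n holds     *)
(* only up to a proof.                                                        *)
Definition fun_cast m n (e : m = n) : Fun m n := [ffun k => cast_ord e k].

Definition fun_tens m n m' n' (f : Fun m n) (g : Fun m' n') :
    Fun (m + m') (n + n') :=
  [ffun k => match split k with
             | inl i => lshift n' (f i)
             | inr j => rshift n (g j)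
             end].

Definition fun_sym m n : Fun (m + n) (n + m) :=
  [ffun k => match split k with
             | inl i => rshift n i
             | inr j => lshift m j
             end].

Definition fun_psi m n : Fun ((1 + m) + (1 + n)) (1 + (m + n)) :=
  [ffun k => match split k with
             | inl i => match split i with
                        | inl _ => ord0
                        | inr i' => rshift 1 (lshift n i')
                        end
             | inr j => match split j with
                        | inl _ => ord0
                        | inr j' => rshift 1 (rshift m j')
                        end
             end].

Definition fun_psi0 : Fun 0 1 := [ffun k => widen_ord (leq0n 1) k].

Fixpoint Gobj P J (A : obj P J) : nat :=
  match A with
  | Letter _ => 1
  | One => 0
  | Tens A B => Gobj A + Gobj B
  | E _ A => 1 + Gobj A
  end.

Fixpoint G P J (A B : obj P J) (f : arr A B) : Fun (Gobj A) (Gobj B) :=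
  match f in arr A B return Fun (Gobj A) (Gobj B) with
  | Id A => fun_id (Gobj A)
  | Assoc A B C => fun_cast (esym (addnA (Gobj A) (Gobj B) (Gobj C)))
  | AssocV A B C => fun_cast (addnA (Gobj A) (Gobj B) (Gobj C))
  | Lunit A => fun_cast (add0n (Gobj A))
  | LunitV A => fun_cast (esym (add0n (Gobj A)))
  | Runit A => fun_cast (addn0 (Gobj A))
  | RunitV A => fun_cast (esym (addn0 (Gobj A)))
  | Sym A B => fun_sym (Gobj A) (Gobj B)
  | Psi _ A B => fun_psi (Gobj A) (Gobj B)
  | Psi0 _ => fun_psi0
  | Comp _ _ _ g f => fun_comp (G g) (G f)
  | TensA _ _ _ _ f g => fun_tens (G f) (G g)
  | EA _ _ _ f => fun_tens (fun_id 1) (G f)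
  end.

Lemma fun_tensl m n m' n' (f : Fun m n) (g : Fun m' n') i :
  fun_tens f g (lshift m' i) = lshift n' (f i).
Proof. by rewrite ffunE (unsplitK (inl i)). Qed.

Lemma fun_tensr m n m' n' (f : Fun m n) (g : Fun m' n') j :
  fun_tens f g (rshift m j) = rshift n (g j).
Proof. by rewrite ffunE (unsplitK (inr j)). Qed.

Lemma fun_syml m n i : fun_sym m n (lshift n i) = rshift n i.
Proof. by rewrite ffunE (unsplitK (inl i)). Qed.

Lemma fun_symr m n j : fun_sym m n (rshift m j) = lshift m j.
Proof. by rewrite ffunE (unsplitK (inr j)). Qed.

Lemma fun_psi_val m n (k : 'I_((1 + m) + (1 + n))) :
  val (fun_psi m n k) = (if k <= m then nat_of_ord k
                         else if nat_of_ord k == m.+1 then 0 else k.-1).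
Proof.
rewrite ffunE; case: (split_ordP k) => i ->.
  case: (split_ordP i) => j ->.
    by rewrite /= (ord1 j).
  by rewrite /= add1n ltn_ord.
case: (split_ordP i) => j ->.
  by rewrite /= (ord1 j) addn0 add1n ltnn eqxx.
have -> : nat_of_ord (rshift (1 + m) (rshift 1 j)) = (m + j).+2.
  by rewrite /= !add1n addnS.
have lt_m : m < (m + j).+1 by rewrite ltnS leq_addr.
by rewrite leqNgt ltnW ?ltnS // gtn_eqF.
Qed.

(* G is well defined on M_c.                                                  *)
Lemma G_arr_eq P J (A B : obj P J) (f g : arr A B) : f ≈ g -> G f = G g.
Proof.
have psil m n i : fun_psi m n (lshift _ (rshift 1 i)) = rshift 1 (lshift n i).
  by rewrite ffunE (unsplitK (inl _)) (unsplitK (inr _)).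
have psir m n i : fun_psi m n (rshift _ (rshift 1 i)) = rshift 1 (rshift m i).
  by rewrite ffunE (unsplitK (inr _)) (unsplitK (inr _)).
have psil0 m n i : fun_psi m n (lshift _ (lshift m i)) = lshift (m + n) ord0.
  by rewrite ffunE (unsplitK (inl _)) (unsplitK (inl _)); apply: val_inj.
have psir0 m n i : fun_psi m n (rshift _ (lshift n i)) = lshift (m + n) ord0.
  by rewrite ffunE (unsplitK (inr _)) (unsplitK (inl _)); apply: val_inj.
have compE m n p (u : Fun n p) (v : Fun m n) k : fun_comp u v k = u (v k).
  by rewrite ffunE.
have idE n k : fun_id n k = k by rewrite ffunE.
have castE m n (e : m = n) k : fun_cast e k = cast_ord e k by rewrite ffunE.
have cA1 m n p (e : m + n + p = m + (n + p)) i :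
    cast_ord e (lshift p (lshift n i)) = lshift (n + p) i by apply: val_inj.
have cA2 m n p (e : m + n + p = m + (n + p)) i :
    cast_ord e (lshift p (rshift m i)) = rshift m (lshift p i) by apply: val_inj.
have cA3 m n p (e : m + n + p = m + (n + p)) i :
    cast_ord e (rshift (m + n) i) = rshift m (rshift n i).
  by apply: val_inj; rewrite /= addnA.
have cl n (e : 0 + n = n) i : cast_ord e (rshift 0 i) = i by apply: val_inj.
have cr n (e : n + 0 = n) i : cast_ord e (lshift 0 i) = i by apply: val_inj.
pose simp := (compE, idE, castE, cA1, cA2, cA3, cl, cr, psil, psir, psil0, psir0,
           fun_tensl, fun_tensr, fun_syml, fun_symr).
move=> fg; elim: A B f g / fg => //=.
- by move=> A B f g h _ -> _ ->.
- by move=> A B C g g' f f' _ -> _ ->.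
- by move=> A B C D f f' g g' _ -> _ ->.
- by move=> i A B f f' _ ->.
all: intros; apply/ffunP => k; rewrite ?simp ?cast_ordK ?cast_ordKV //.
all: repeat match goal with
  | x : 'I_0 |- _ => by case: x
  | |- context [fun_of_fin _ ?x] => is_var x; case: (split_ordP x) => ? ->
  | |- context [lshift _ ?x] => is_var x; case: (split_ordP x) => ? ->
  | |- context [rshift _ ?x] => is_var x; case: (split_ordP x) => ? ->
  end; rewrite ?simp //.
all: by congr lshift; rewrite [RHS]ord1.
Qed.

(* Main.v *)
From Stdlib Require Import Setoid Morphisms ProofIrrelevance.
From mathcomp Require Import all_boot.
Require Import Defs.

(** The function [G f] remembers, for each generator occurring in the source,
the occurrence in the target to which it is sent, and by induction on the target
this is enough to rebuild [f] up to [≈].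

- The target is a tensor [B1 ⊗ B2].  Every object splits, along a symmetric
  monoidal isomorphism [cut], into the part that goes to [B1] and the part that
  goes to [B2], and an arrow into [B1 ⊗ B2] is, up to an isomorphism that depends
  on the target alone, a tensor of an arrow into [B1] with an arrow into [B2],
  preceded by a [cut] of its source ([tens_target]).  [G f] determines which
  outermost generators of the source go to the left ([cut_inj]), hence the [cut],
  and as [G] of an isomorphism is onto it determines [G] of both factors.
- The target is [E i B].  Then all outermost generators of the source are [E i],
  and [f] first gathers them into a single one by iterating [Psi] and [Psi0], and
  then does something under [E i] ([gather_nat]).  The gathering arrow depends on
  the source only, so the induction hypothesis applies to what is under [E i].
- The target is a letter or [One].  No functor can occur in the source, and the
  claim is an instance of coherence for symmetric monoidal categories
  ([noE_coherence]).

The three decompositions are proved in the same way, by induction on the arrow.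
Each says that some family of arrows out of [A], indexed by extra data on [A], is
natural in the sense that data on the target can be pulled back to the source.
For [gather] the verification for the generating arrows is literally the
definition of a linear endofunctor.  For [cut] it says that [⊗] is itself a
symmetric monoidal functor, i.e. it consists of equations between composites of
associativities, unit and symmetry arrows.  These are obtained by substituting
arbitrary objects for the letters in instances of [noE_coherence], which is
therefore proved first, by extracting the letters of the target one at a time
([extract_nat]). *)
Set Implicit Arguments.
Unset Strict Implicit.
Unset Printing Implicit Defensive.

(** * Rewriting modulo the equality of arrows *)
#[local] Instance arr_eq_equiv P J (A B : obj P J) : Equivalence (@arr_eq P J A B).
Proof.
split; first exact: arr_refl; first exact: arr_sym.
by move=> f g h; apply: arr_trans.
Qed.

#[local] Instance Comp_proper P J (A B C : obj P J) :
  Proper (@arr_eq P J B C ==> @arr_eq P J A B ==> @arr_eq P J A C) (@Comp P J A B C).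
Proof. by move=> g g' eg f f' ef; apply: cong_comp. Qed.

#[local] Instance TensA_proper P J (A B C D : obj P J) :
  Proper (@arr_eq P J A B ==> @arr_eq P J C D ==> @arr_eq P J (A ⊗ C) (B ⊗ D))
         (@TensA P J A B C D).
Proof. by move=> f f' ef g g' eg; apply: cong_tens. Qed.

#[local] Instance EA_proper P J i (A B : obj P J) :
  Proper (@arr_eq P J A B ==> @arr_eq P J (E i A) (E i B)) (@EA P J i A B).
Proof. by move=> f f' ef; apply: cong_E. Qed.

#[local] Hint Resolve arr_refl : core.

#[local] Open Scope arr_scope.

Section Basics.
Variables P J : Type.
Implicit Types A B C D : obj P J.

(** [chain] and [chain3] let an equation between composites be used for rewriting
inside a longer composite that is associated to the right. *)
Lemma chain A B C D (g : arr C D) (f : arr B C) (h : arr B D) :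
  g ∘ f ≈ h -> forall k : arr A B, g ∘ (f ∘ k) ≈ h ∘ k.
Proof. by move=> e k; rewrite comp_assoc e. Qed.

Lemma chain3 A B C D X (h : arr C D) (g : arr B C) (f : arr A B) (r : arr A D) :
  h ∘ (g ∘ f) ≈ r -> forall k : arr X A, h ∘ (g ∘ (f ∘ k)) ≈ r ∘ k.
Proof. by move=> e k; rewrite -e -!comp_assoc. Qed.

Lemma tens_compl A B C D (g : arr B C) (f : arr A B) :
  (g ⊗ Id D) ∘ (f ⊗ Id D) ≈ (g ∘ f) ⊗ Id D.
Proof. by rewrite -tens_comp comp_idl. Qed.

Lemma tens_compr A B C D (g : arr B C) (f : arr A B) :
  (Id D ⊗ g) ∘ (Id D ⊗ f) ≈ Id D ⊗ (g ∘ f).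
Proof. by rewrite -tens_comp comp_idl. Qed.

Lemma tens_post_l A B C D X (g : arr B C) (f : arr A B) (h : arr D X) :
  (g ∘ f) ⊗ h ≈ (g ⊗ Id X) ∘ (f ⊗ h).
Proof. by rewrite -tens_comp comp_idl. Qed.

Lemma tens_post_r A B C D X (g : arr B C) (f : arr A B) (h : arr D X) :
  h ⊗ (g ∘ f) ≈ (Id X ⊗ g) ∘ (h ⊗ f).
Proof. by rewrite -tens_comp comp_idl. Qed.

End Basics.

(** * Isomorphisms *)
Section Iso.
Variables P J : Type.
Implicit Types A B C D : obj P J.

Definition iso A B (f : arr A B) : Prop := exists2 g : arr B A, g ∘ f ≈ Id A & f ∘ g ≈ Id B.

Lemma iso_id A : iso (Id A).
Proof. by exists (Id A); rewrite comp_idl. Qed.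

Lemma iso_comp A B C (g : arr B C) (f : arr A B) : iso g -> iso f -> iso (g ∘ f).
Proof.
move=> [g' g'g gg'] [f' f'f ff']; exists (f' ∘ g').
  by rewrite -comp_assoc (chain g'g) comp_idl.
by rewrite -comp_assoc (chain ff') comp_idl.
Qed.

Lemma iso_tens A B C D (f : arr A B) (g : arr C D) : iso f -> iso g -> iso (f ⊗ g).
Proof.
move=> [f' f'f ff'] [g' g'g gg']; exists (f' ⊗ g').
  by rewrite -tens_comp f'f g'g tens_id.
by rewrite -tens_comp ff' gg' tens_id.
Qed.

Lemma iso_assoc A B C : iso (Assoc A B C).
Proof. by exists (AssocV A B C); [apply: assocK | apply: assocVK]. Qed.

Lemma iso_assocV A B C : iso (AssocV A B C).
Proof. by exists (Assoc A B C); [apply: assocVK | apply: assocK]. Qed.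

Lemma iso_lunit A : iso (Lunit A).
Proof. by exists (LunitV A); [apply: lunitK | apply: lunitVK]. Qed.

Lemma iso_lunitV A : iso (LunitV A).
Proof. by exists (Lunit A); [apply: lunitVK | apply: lunitK]. Qed.

Lemma iso_runit A : iso (Runit A).
Proof. by exists (RunitV A); [apply: runitK | apply: runitVK]. Qed.

Lemma iso_runitV A : iso (RunitV A).
Proof. by exists (Runit A); [apply: runitVK | apply: runitK]. Qed.

Lemma iso_sym A B : iso (Sym A B).
Proof. by exists (Sym B A); apply: symK. Qed.

Lemma iso_mono A B C (u : arr B C) (f g : arr A B) : iso u -> u ∘ f ≈ u ∘ g -> f ≈ g.
Proof.
by move=> [v vu _] e; rewrite -(comp_idl f) -vu -comp_assoc e comp_assoc vu comp_idl.
Qed.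

Lemma iso_epi A B C (u : arr A B) (f g : arr B C) : iso u -> f ∘ u ≈ g ∘ u -> f ≈ g.
Proof.
by move=> [v _ uv] e; rewrite -(comp_idr f) -uv comp_assoc e -comp_assoc uv comp_idr.
Qed.

End Iso.

#[local] Hint Resolve iso_id iso_comp iso_tens iso_assoc iso_assocV iso_lunit
  iso_lunitV iso_runit iso_runitV iso_sym : core.

(** * Elementary consequences of the symmetric monoidal equations *)
Section Coherence.
Variables P J : Type.
Implicit Types A B C D : obj P J.

Lemma assocV_nat A B C A' B' C' (f : arr A A') (g : arr B B') (h : arr C C') :
  AssocV A' B' C' ∘ (f ⊗ (g ⊗ h)) ≈ ((f ⊗ g) ⊗ h) ∘ AssocV A B C.
Proof.
apply: (iso_mono (iso_assoc _ _ _)).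
rewrite (chain (assocVK _ _ _)) comp_idl (chain (assoc_nat _ _ _)) -comp_assoc.
by rewrite assocVK comp_idr.
Qed.

Lemma pentagonV A B C D :
  Assoc (A ⊗ B) C D ∘ (AssocV A B C ⊗ Id D)
  ≈ AssocV A B (C ⊗ D) ∘ ((Id A ⊗ Assoc B C D) ∘ Assoc A (B ⊗ C) D).
Proof.
apply: (iso_mono (iso_assoc _ _ _)); rewrite (chain (assocVK _ _ _)) comp_idl.
rewrite (chain (pentagon _ _ _ _)) -!comp_assoc tens_compl assocVK tens_id.
by rewrite comp_idr.
Qed.

(** Tensoring with the unit is naturally isomorphic to the identity functor, hence
faithful.  The unit equations below are first proved after such a tensoring, where
the pentagon and the triangle can be used. *)
Lemma tens1_inj A B (f g : arr A B) : Id One ⊗ f ≈ Id One ⊗ g -> f ≈ g.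
Proof.
by move=> e; apply: (iso_epi (iso_lunit _)); rewrite -!lunit_nat e.
Qed.

Lemma tensr1_inj A B (f g : arr A B) : f ⊗ Id One ≈ g ⊗ Id One -> f ≈ g.
Proof.
by move=> e; apply: (iso_epi (iso_runit _)); rewrite -!runit_nat e.
Qed.

Lemma lunit_assoc A B : Lunit (A ⊗ B) ∘ Assoc One A B ≈ Lunit A ⊗ Id B.
Proof.
apply: tens1_inj.
have iu : iso (Assoc One (One ⊗ A) B ∘ (Assoc One One A ⊗ Id B)) by auto.
apply: (iso_epi iu); rewrite -tens_compr -!comp_assoc.
have := pentagon One One A B; rewrite -!comp_assoc => <-.
rewrite (chain (triangle _ _)) (chain (symmetry (assoc_nat _ _ _))) -comp_assoc.
by rewrite tens_compl triangle -tens_id assoc_nat.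
Qed.

Lemma runit_assoc A B : (Id A ⊗ Runit B) ∘ Assoc A B One ≈ Runit (A ⊗ B).
Proof.
apply: tensr1_inj; apply: (iso_mono (iso_assoc _ _ _)).
rewrite -tens_compl (chain (assoc_nat _ _ _)) -comp_assoc -triangle -tens_compr.
rewrite -comp_assoc.
have := pentagon A B One One; rewrite -!comp_assoc => <-.
by rewrite (chain (symmetry (assoc_nat _ _ _))) tens_id -comp_assoc triangle.
Qed.

Lemma lunit_runit : Lunit (One : obj P J) ≈ Runit One.
Proof.
apply: tensr1_inj; rewrite -triangle -lunit_assoc; apply: cong_comp => //.
by apply: (iso_mono (iso_lunit _)); rewrite lunit_nat.
Qed.

(** The hexagon with two unit objects, followed by [Lunit], gives this equation
tensored with [One] and composed with a symmetry, which can be cancelled. *)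
Lemma lunit_sym A : Lunit A ∘ Sym A One ≈ Runit A.
Proof.
apply: tensr1_inj; apply: (iso_mono (iso_sym _ _)).
have := hexagon A One One; rewrite -!comp_assoc => h.
rewrite -tens_compl -lunit_assoc -!comp_assoc.
rewrite (chain (symmetry (lunit_nat _))) -!comp_assoc -h.
rewrite (chain (lunit_assoc _ _)) (chain (symmetry (sym_nat _ _))) -!comp_assoc.
by rewrite triangle.
Qed.

Lemma runit_sym A : Runit A ∘ Sym One A ≈ Lunit A.
Proof. by rewrite -lunit_sym -comp_assoc symK comp_idr. Qed.

Lemma sym_one : Sym One One ≈ Id ((One : obj P J) ⊗ One).
Proof.
by apply: (iso_mono (iso_lunit _)); rewrite lunit_sym comp_idr lunit_runit.
Qed.

(** The symmetry acting inside a tensor associated to the right.  It is locked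
because it is itself a composite: otherwise pattern matching would unfold it. *)
Definition swap A B C : arr (A ⊗ (B ⊗ C)) (B ⊗ (A ⊗ C)) :=
  locked (Assoc B A C ∘ ((Sym A B ⊗ Id C) ∘ AssocV A B C))%arr.

Lemma swapE A B C :
  swap A B C = (Assoc B A C ∘ ((Sym A B ⊗ Id C) ∘ AssocV A B C))%arr.
Proof. by rewrite /swap -lock. Qed.

Lemma iso_swap A B C : iso (swap A B C).
Proof. by rewrite !swapE; auto 6. Qed.

Lemma swap_nat A B C A' B' C' (f : arr A A') (g : arr B B') (h : arr C C') :
  swap A' B' C' ∘ (f ⊗ (g ⊗ h)) ≈ (g ⊗ (f ⊗ h)) ∘ swap A B C.
Proof.
rewrite !swapE -!comp_assoc assocV_nat (chain (symmetry (tens_comp _ _ _ _))).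
rewrite sym_nat comp_idl -{1}(comp_idr h) tens_comp -!comp_assoc.
by rewrite (chain (assoc_nat _ _ _)) -comp_assoc.
Qed.

(** An arrow [swap] does not interfere with what stands to the right of the objects
that it exchanges. *)
Lemma swap_assoc_r A B C D :
  swap A B (C ⊗ D) ∘ ((Id A ⊗ Assoc B C D) ∘ Assoc A (B ⊗ C) D)
  ≈ (Id B ⊗ Assoc A C D) ∘ (Assoc B (A ⊗ C) D ∘ (swap A B C ⊗ Id D)).
Proof.
rewrite !swapE -!comp_assoc -pentagonV -!tens_compl.
have p := pentagon B A C D; rewrite -!comp_assoc in p.
rewrite (chain3 (symmetry p)) -!comp_assoc -tens_id.
by rewrite (chain (assoc_nat _ _ _)) -comp_assoc tens_id.
Qed.

(** The hexagon for a tensor on the left, by inverting the given hexagon. *)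
Lemma sym_tens_l A B C :
  Sym (A ⊗ B) C ≈
  Assoc C A B ∘ ((Sym A C ⊗ Id B) ∘ (AssocV A C B ∘ ((Id A ⊗ Sym B C) ∘ Assoc A B C))).
Proof.
have h := hexagon C A B; rewrite -!comp_assoc in h.
apply: (iso_epi (iso_sym C (A ⊗ B))); rewrite symK.
apply: (iso_epi (iso_assoc C A B)); rewrite -!comp_assoc h comp_idl.
rewrite (chain (tens_compr _ _ _)) symK tens_id comp_idl (chain (assocK _ _ _)) comp_idl.
by rewrite tens_compl symK tens_id comp_idr.
Qed.

(** Moving [C] past [A ⊗ B] amounts to moving it past [B] and then past [A]. *)
Lemma swap_assoc_l A B C D :
  swap A C (B ⊗ D) ∘ ((Id A ⊗ swap B C D) ∘ Assoc A B (C ⊗ D))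
  ≈ (Id C ⊗ Assoc A B D) ∘ swap (A ⊗ B) C D.
Proof.
rewrite (swapE (A ⊗ B)) sym_tens_l -!tens_compl -!comp_assoc.
have p := pentagon C A B D; rewrite -!comp_assoc in p.
rewrite (chain3 (symmetry p)) -!comp_assoc (chain (assoc_nat _ _ _)) -!comp_assoc.
rewrite (chain (pentagonV _ _ _ _)) -!comp_assoc (chain (assoc_nat _ _ _)) -!comp_assoc.
rewrite !swapE -!tens_compr -!comp_assoc tens_id.
do 4 apply: cong_comp => //.
apply: cong_comp => //.
apply: (iso_epi (iso_assoc _ _ _)); rewrite -!comp_assoc.
rewrite assocK comp_idr.
have p2 := pentagon A B C D; rewrite -!comp_assoc in p2.
by rewrite p2 (chain (tens_compr _ _ _)) assocK tens_id comp_idl.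
Qed.

Lemma swap_lunit A B : (Id A ⊗ Lunit B) ∘ swap One A B ≈ Lunit (A ⊗ B).
Proof.
rewrite !swapE (chain (triangle _ _)) (chain (tens_compl _ _ _)) runit_sym -lunit_assoc.
by rewrite -comp_assoc assocVK comp_idr.
Qed.

Lemma swap_sym_l A B C :
  Assoc A B C ∘ Sym C (A ⊗ B) ≈ (Id A ⊗ Sym C B) ∘ swap C A B.
Proof.
have h := hexagon C A B; rewrite -!comp_assoc in h.
apply: (iso_epi (iso_assoc _ _ _)); rewrite -!comp_assoc h !swapE -?comp_assoc.
by rewrite assocK comp_idr.
Qed.

Lemma swap_sym_r A B C :
  swap A B C ∘ Sym (B ⊗ C) A ≈ (Id B ⊗ Sym C A) ∘ Assoc B C A.
Proof.
have e : swap A B C ≈ (Id B ⊗ Sym C A) ∘ (Assoc B C A ∘ Sym A (B ⊗ C)).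
  by rewrite swap_sym_l (chain (tens_compr _ _ _)) symK tens_id comp_idl.
by rewrite e -!comp_assoc symK comp_idr.
Qed.

End Coherence.

(** * The functions assigned to arrows *)
Section Functions.
Variables P J : Type.
Implicit Types A B C D : obj P J.

Lemma G_comp A B C (g : arr B C) (f : arr A B) k : G (g ∘ f) k = G g (G f k).
Proof. by rewrite ffunE. Qed.

Lemma iso_surj A B (f : arr A B) : iso f -> forall k, exists j, G f j = k.
Proof.
move=> [g _ /G_arr_eq fg] k; exists (G g k).
by rewrite -G_comp fg ffunE.
Qed.

Variant tens_ord_spec A B (k : 'I_(Gobj (A ⊗ B))) : Prop :=
| TensOrdL (i : 'I_(Gobj A)) of k = lshift (Gobj B) i
| TensOrdR (i : 'I_(Gobj B)) of k = rshift (Gobj A) i.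

Lemma tens_ordP A B (k : 'I_(Gobj (A ⊗ B))) : tens_ord_spec k.
Proof. by case: (split_ordP k) => i; [left with i | right with i]. Qed.

Lemma G_assoc1 A B C i : G (Assoc A B C) (lshift _ (lshift _ i)) = lshift _ i.
Proof. by rewrite [LHS]ffunE; apply: val_inj. Qed.

Lemma G_assoc2 A B C i : G (Assoc A B C) (lshift _ (rshift _ i)) = rshift _ (lshift _ i).
Proof. by rewrite [LHS]ffunE; apply: val_inj. Qed.

Lemma G_assoc3 A B C i : G (Assoc A B C) (rshift _ i) = rshift _ (rshift _ i).
Proof. by rewrite [LHS]ffunE; apply: val_inj; rewrite /= addnA. Qed.

Lemma G_assocV1 A B C i : G (AssocV A B C) (lshift _ i) = lshift _ (lshift _ i).
Proof. by rewrite [LHS]ffunE; apply: val_inj. Qed.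

Lemma G_assocV2 A B C i : G (AssocV A B C) (rshift _ (lshift _ i)) = lshift _ (rshift _ i).
Proof. by rewrite [LHS]ffunE; apply: val_inj. Qed.

Lemma G_assocV3 A B C i : G (AssocV A B C) (rshift _ (rshift _ i)) = rshift _ i.
Proof. by rewrite [LHS]ffunE; apply: val_inj; rewrite /= addnA. Qed.

Lemma G_lunit A i : G (Lunit A) (rshift 0 i) = i.
Proof. by rewrite ffunE; apply: val_inj. Qed.

Lemma G_runit A i : G (Runit A) (lshift 0 i) = i.
Proof. by rewrite ffunE; apply: val_inj. Qed.

Lemma G_lunitV A i : G (LunitV A) i = rshift 0 i.
Proof. by rewrite ffunE; apply: val_inj. Qed.

Lemma G_runitV A i : G (RunitV A) i = lshift 0 i.
Proof. by rewrite ffunE; apply: val_inj. Qed.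

Lemma G_id A i : G (Id A) i = i.
Proof. by rewrite ffunE. Qed.

Lemma G_tensl A B C D (f : arr A B) (g : arr C D) i :
  G (f ⊗ g) (lshift _ i) = lshift _ (G f i).
Proof. exact: fun_tensl. Qed.

Lemma G_tensr A B C D (f : arr A B) (g : arr C D) i :
  G (f ⊗ g) (rshift _ i) = rshift _ (G g i).
Proof. exact: fun_tensr. Qed.

Lemma G_syml A B i : G (Sym A B) (lshift _ i) = rshift _ i.
Proof. exact: fun_syml. Qed.

Lemma G_symr A B i : G (Sym A B) (rshift _ i) = lshift _ i.
Proof. exact: fun_symr. Qed.

Definition G_simp :=
  (G_comp, G_id, G_assoc1, G_assoc2, G_assoc3, G_assocV1, G_assocV2, G_assocV3,
   G_lunit, G_runit, G_lunitV, G_runitV, G_tensl, G_tensr, G_syml, G_symr).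

Lemma G_swap1 A B C i : G (swap A B C) (lshift _ i) = rshift _ (lshift _ i).
Proof. by rewrite swapE !G_simp. Qed.

Lemma G_swap2 A B C i : G (swap A B C) (rshift _ (lshift _ i)) = lshift _ i.
Proof. by rewrite swapE !G_simp. Qed.

Lemma G_swap3 A B C i : G (swap A B C) (rshift _ (rshift _ i)) = rshift _ (rshift _ i).
Proof. by rewrite swapE !G_simp. Qed.

End Functions.

(** * Objects without generators *)
Section Null.
Variables P J : Type.
Implicit Types A B C D : obj P J.

(** Type-valued, like the other families of data on objects below, so that arrows
can be defined by recursion on the object together with such data. *)
Fixpoint null A : Type :=
  match A with
  | Letter _ => void
  | One => unit
  | Tens A B => (null A * null B)%type
  | E _ _ => void
  end.

Fixpoint toI A : null A -> arr A One :=
  match A with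
  | Letter _ => fun n => match n with end
  | One => fun _ => Id One
  | Tens A B => fun n => Lunit One ∘ (toI n.1 ⊗ toI n.2)
  | E _ _ => fun n => match n with end
  end.

Lemma null_unique A (n n' : null A) : n = n'.
Proof.
elim: A n n' => [p||A IA B IB|i A _] //=; first by move=> [] [].
by move=> [a b] [a' b']; rewrite (IA a a') (IB b b').
Qed.

Lemma iso_toI A (n : null A) : iso (toI n).
Proof. by elim: A n => [p||A IA B IB|i A _] //= n; auto. Qed.

(** An arrow into an object built from [One] alone has a source of the same kind,
since every generating arrow creates or keeps generators: [Psi] and [Psi0] have an
[E i] in their target.  Such an arrow respects the canonical isomorphisms to
[One]. *)
Lemma toI_nat A B (f : arr A B) (n : null B) : exists n', toI n ∘ f ≈ toI n'.
Proof.
elim: A B / f n => /=.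
- by move=> A n; exists n; rewrite comp_idr.
- move=> A B C [a [b c]] /=; exists ((a, b), c) => /=.
  rewrite -{1}(comp_idl (toI a)) tens_comp -!comp_assoc -assoc_nat.
  rewrite (chain (triangle _ _)) -(lunit_runit P J) -tens_comp.
  by rewrite comp_idl.
- move=> A B C [[a b] c] /=; exists (a, (b, c)) => /=.
  apply: (iso_epi (iso_assoc _ _ _)); rewrite -!comp_assoc assocK comp_idr.
  rewrite -{2}(comp_idl (toI a)) tens_comp -!comp_assoc -assoc_nat.
  rewrite (chain (triangle _ _)) -(lunit_runit P J) -tens_comp.
  by rewrite comp_idl.
- by move=> A a; exists (tt, a); rewrite lunit_nat.
- by move=> A [[] a] /=; exists a; rewrite lunit_nat -comp_assoc lunitVK comp_idr.
- by move=> A a; exists (a, tt) => /=; rewrite -runit_nat lunit_runit.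
- move=> A [a []] /=; exists a.
  by rewrite lunit_runit runit_nat -comp_assoc runitVK comp_idr.
- move=> A B [b a]; exists (a, b) => /=.
  by rewrite -comp_assoc -sym_nat sym_one comp_idl.
- by move=> i A B [].
- by move=> i [].
- move=> A B C g IHg f IHf n; have [n' e] := IHg n; have [n'' e'] := IHf n'.
  by exists n''; rewrite comp_assoc e.
- move=> A B C D f IHf g IHg [a b] /=.
  have [a' ea] := IHf a; have [b' eb] := IHg b; exists (a', b') => /=.
  by rewrite -comp_assoc -tens_comp ea eb.
- by move=> i A B f _ [].
Qed.

Lemma null_coherence A B (n : null B) (f g : arr A B) : f ≈ g.
Proof.
have [a ea] := toI_nat f n; have [b eb] := toI_nat g n.
by apply: (iso_mono (iso_toI n)); rewrite ea eb (null_unique a b).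
Qed.

End Null.

(** * Coherence for arrows whose target contains no functor *)
Section Letters.
Variables P J : Type.
Implicit Types A B C D : obj P J.

Fixpoint noE A : Type :=
  match A with
  | Letter _ | One => unit
  | Tens A B => (noE A * noE B)%type
  | E _ _ => void
  end.

(** Occurrences of the letter [x] outside of all functors.  Carrying the equation
[y = x] at a letter makes the letter part of the type, so that matching
occurrences in the source and in the target of an arrow carry the same letter
without any transport. *)
Fixpoint pos (x : P) A : Type :=
  match A with
  | Letter y => y = x
  | One => void
  | Tens A B => (pos x A + pos x B)%type
  | E _ _ => void
  end.

Fixpoint rest x A : pos x A -> obj P J :=
  match A with
  | Letter _ => fun _ => One
  | One => fun k => match k with end
  | Tens A B => fun k => match k with
                         | inl k => rest k ⊗ B
                         | inr k => A ⊗ rest k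
                         end%obj
  | E _ _ => fun k => match k with end
  end.

(** The isomorphism that moves a chosen letter to the front. *)
Fixpoint extract x A : forall k : pos x A, arr A (Letter x ⊗ rest k) :=
  match A with
  | Letter y => fun e => match e in _ = z return arr (Letter y) (Letter z ⊗ One) with
                         | erefl => RunitV (Letter y)
                         end
  | One => fun k => match k with end
  | Tens A B => fun k => match k with
                         | inl k => Assoc (Letter x) (rest k) B ∘ (extract k ⊗ Id B)
                         | inr k => swap A (Letter x) (rest k) ∘ (Id A ⊗ extract k)
                         end
  | E _ _ => fun k => match k with end
  end.

Lemma iso_extract x A (k : pos x A) : iso (extract k).
Proof.
elim: A k => [y||A IA B IB|i A _] //=; first by case: x /; auto.
by case=> k; auto using iso_swap.
Qed.

Lemma noE_source A B (f : arr A B) : noE B -> noE A.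
Proof.
elim: A B / f => //=.
- by move=> A B C [? []].
- by move=> A B C [[]].
- by move=> A [].
- by move=> A [].
- by move=> A B [].
- by move=> A B C g IHg f IHf /IHg.
- by move=> A B C D f IHf g IHg [] /IHf ? /IHg.
Qed.

(** An arrow into an object with no functors sends one letter of its source to each
letter of its target, and acts separately on that letter and on the rest. *)
Lemma extract_nat x A B (f : arr A B) (nB : noE B) (k : pos x B) :
  exists (k' : pos x A) (f' : arr (rest k') (rest k)),
    extract k ∘ f ≈ (Id (Letter x) ⊗ f') ∘ extract k'.
Proof.
elim: A B / f nB k => //=.
- by move=> A _ k; exists k, (Id _); rewrite tens_id comp_idl comp_idr.
- move=> A B C _ [k|[k|k]] /=.
  + exists (inl (inl k)), (Assoc _ _ _) => /=.
    rewrite -tens_id -comp_assoc -assoc_nat -tens_compl.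
    have := pentagon (Letter x) (rest k) B C; rewrite -!comp_assoc => p.
    by rewrite (chain3 (symmetry p)) -!comp_assoc.
  + exists (inl (inr k)), (Assoc _ _ _) => /=.
    rewrite -tens_compr -!comp_assoc -assoc_nat -tens_compl.
    by rewrite (chain3 (swap_assoc_r _ _ _ _)) -!comp_assoc.
  + exists (inr k), (Assoc _ _ _) => /=.
    rewrite -tens_compr -!comp_assoc -assoc_nat tens_id.
    by rewrite (chain3 (swap_assoc_l _ _ _ _)) -!comp_assoc.
- move=> A B C _ [[k|k]|k] /=.
  + exists (inl k), (AssocV _ _ _) => /=; apply: (iso_epi (iso_assoc _ _ _)).
    rewrite -!comp_assoc assocK comp_idr -tens_id -assoc_nat -tens_compl.
    have := pentagon (Letter x) (rest k) B C; rewrite -!comp_assoc => p.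
    rewrite (chain p) -!comp_assoc (chain (tens_compr _ _ _)) assocK tens_id.
    by rewrite comp_idl.
  + exists (inr (inl k)), (AssocV _ _ _) => /=; apply: (iso_epi (iso_assoc _ _ _)).
    rewrite -!comp_assoc assocK comp_idr -tens_compr -!comp_assoc -assoc_nat -tens_compl.
    rewrite (chain3 (swap_assoc_r _ _ _ _)) (chain (chain (tens_compr _ _ _) _)).
    by rewrite assocK tens_id comp_idl -!comp_assoc.
  + exists (inr (inr k)), (AssocV _ _ _) => /=; apply: (iso_epi (iso_assoc _ _ _)).
    rewrite -!comp_assoc assocK comp_idr -tens_compr -!comp_assoc -assoc_nat tens_id.
    rewrite (chain3 (swap_assoc_l _ _ _ _)) -!comp_assoc (chain (tens_compr _ _ _)).
    by rewrite assocK tens_id comp_idl.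
- move=> A _ k; exists (inr k), (Lunit _) => /=.
  by rewrite (chain (swap_lunit _ _)) lunit_nat.
- move=> A _ [[]|k] /=; exists k, (LunitV _); apply: (iso_epi (iso_lunit _)).
  rewrite -!comp_assoc lunitK comp_idr -lunit_nat -swap_lunit -comp_assoc.
  by rewrite (chain (tens_compr _ _ _)) lunitK tens_id comp_idl.
- move=> A _ k; exists (inl k), (Runit _) => /=.
  by rewrite (chain (runit_assoc _ _)) runit_nat.
- move=> A _ [k|[]] /=; exists k, (RunitV _); apply: (iso_epi (iso_runit _)).
  rewrite -!comp_assoc runitK comp_idr -runit_nat -runit_assoc -comp_assoc.
  by rewrite (chain (tens_compr _ _ _)) runitK tens_id comp_idl.
- move=> A B _ [k|k] /=.
  + exists (inr k), (Sym _ _) => /=.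
    by rewrite -comp_assoc -sym_nat (chain (swap_sym_l _ _ _)) -comp_assoc.
  + exists (inl k), (Sym _ _) => /=.
    by rewrite -comp_assoc -sym_nat (chain (swap_sym_r _ _ _)) -comp_assoc.
- move=> A B C g IHg f IHf nC k.
  have [k' [g' eg]] := IHg nC k; have [k'' [f' ef]] := IHf (noE_source g nC) k'.
  exists k'', (g' ∘ f').
  by rewrite comp_assoc eg -comp_assoc ef comp_assoc tens_compr.
- move=> A B C D f IHf g IHg [nB nD] [k|k] /=.
  + have [k' [f' ef]] := IHf nB k; exists (inl k'), (f' ⊗ g) => /=.
    rewrite -comp_assoc -tens_comp ef comp_idl -{1}(comp_idr g) tens_comp.
    by rewrite (chain (assoc_nat _ _ _)) -comp_assoc.
  + have [k' [g' eg]] := IHg nD k; exists (inr k'), (f ⊗ g') => /=.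
    rewrite -comp_assoc -tens_comp eg comp_idl -{1}(comp_idr f) tens_comp.
    by rewrite (chain (swap_nat _ _ _)) -comp_assoc.
Qed.

Lemma extract_inl x A B (k : pos x A) :
  extract (inl k : pos x (A ⊗ B)) = (Assoc (Letter x) (rest k) B ∘ (extract k ⊗ Id B))%arr.
Proof. by []. Qed.

Lemma extract_inr x A B (k : pos x B) :
  extract (inr k : pos x (A ⊗ B)) = (swap A (Letter x) (rest k) ∘ (Id A ⊗ extract k))%arr.
Proof. by []. Qed.

(** [G (extract k)] sends exactly one element to [0], namely the index of the
occurrence [k]; this index determines [k]. *)
Lemma extract_inj x A (k k' : pos x A) :
  (forall j, (G (extract k) j == 0 :> nat) = (G (extract k') j == 0 :> nat)) -> k = k'.
Proof.
have G_inl A' B (l : pos x A') j :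
  G (extract (inl l : pos x (A' ⊗ B))) (lshift _ j) = G (extract l) j :> nat.
  rewrite extract_inl !G_simp; move: (G (extract l) j) => i.
  by case: (tens_ordP i) => {}i ->; rewrite !G_simp.
have G_inr A' B (l : pos x B) (j : 'I_(Gobj A')) :
  G (extract (inr l : pos x (A' ⊗ B))) (lshift _ j) = j.+1 :> nat.
  by rewrite extract_inr !G_simp G_swap1.
have G_inr2 A' B (l : pos x B) j :
  (G (extract (inr l : pos x (A' ⊗ B))) (rshift _ j) == 0 :> nat)
  = (G (extract l) j == 0 :> nat).
  rewrite extract_inr !G_simp; move: (G (extract l) j) => i.
  by case: (tens_ordP i) => {}i ->; rewrite ?G_swap2 ?G_swap3.
have lr A' B (l : pos x A') (r : pos x B) :
  ~ forall j, (G (extract (inl l : pos x (A' ⊗ B))) j == 0 :> nat)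
            = (G (extract (inr r : pos x (A' ⊗ B))) j == 0 :> nat).
  have [j ej] := iso_surj (iso_extract l) ord0.
  by move=> /(_ (lshift _ j)); rewrite G_inl ej G_inr.
elim: A k k' => [y||A IA B IB|i A _] //=.
  by move=> k k' _; apply: proof_irrelevance.
move=> [k|k] [k'|k'] e.
- by congr inl; apply: IA => j; have := e (lshift _ j); rewrite !G_inl.
- by case: (lr _ _ _ _ e).
- by case: (lr _ _ _ _ (fun j => esym (e j))).
- by congr inr; apply: IB => j; have := e (rshift _ j); rewrite !G_inr2.
Qed.

Lemma noE_rest x A (k : pos x A) : noE A -> noE (rest k).
Proof.
elim: A k => [y||A IA B IB|i A _] //= [k|k] [a b] /=; split=> //; first exact: IA.
exact: IB.
Qed.

Lemma Gobj_rest x A (k : pos x A) : Gobj A = (Gobj (rest k)).+1.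
Proof.
elim: A k => [y||A IA B IB|i A _] //= [k|k] /=; first by rewrite (IA k).
by rewrite (IB k) addnS.
Qed.

Lemma null_or_pos A : noE A -> null A + {x & pos x A}.
Proof.
elim: A => [y||A IA B IB|i A _] //=; [by right; exists y | by left |].
move=> [/IA [a|[x k]] /IB [b|[y l]]]; first by left.
- by right; exists y; right.
- by right; exists x; left.
- by right; exists x; left.
Qed.

(** Coherence for symmetric monoidal categories.  By induction on the number of
letters of the target: extract one letter [k] of the target.  [f] and [g] both
factor through [extract] of a letter of the source, the same one because [G]
is the same, and the induction hypothesis applies to the arrows between the
rests. *)
Lemma noE_coherence A B (f g : arr A B) : noE B -> G f = G g -> f ≈ g.
Proof.
have [n] := ubnP (Gobj B); elim: n => // n IHn in A B f g *.
move=> le_B nB Gfg; have [b|[x k]] := null_or_pos nB; first exact: null_coherence.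
have [k' [f' ef]] := extract_nat f nB k; have [k'' [g' eg]] := extract_nat g nB k.
have tens_eq0 C D (h : arr C D) j :
    (G (Id (Letter x) ⊗ h) j == 0 :> nat) = (j == 0 :> nat).
  by case: (tens_ordP j) => i ->; rewrite !G_simp.
have Gf j : G (Id (Letter x) ⊗ f') (G (extract k') j) = G (extract k) (G f j).
  by rewrite -!G_comp (G_arr_eq ef).
have Gg j : G (Id (Letter x) ⊗ g') (G (extract k'') j) = G (extract k) (G f j).
  by rewrite Gfg -!G_comp (G_arr_eq eg).
have ek : k' = k'' by apply: extract_inj => j; rewrite -(tens_eq0 _ _ f') Gf -Gg tens_eq0.
case: _ / ek in g' eg Gg.
apply: (iso_mono (iso_extract k)); rewrite ef eg; apply: cong_comp => //.
apply: cong_tens => //; apply: IHn; first by rewrite -ltnS -(Gobj_rest k).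
  exact: noE_rest.
apply/ffunP => i.
have [j ej] := iso_surj (iso_extract k') (rshift 1 i).
by have := Gf j; rewrite -Gg ej !G_tensr => /rshift_inj.
Qed.

End Letters.

(** * Substitution of objects for letters *)
Section Substitution.
Variables (Q P J : Type) (s : Q -> obj P J).

Fixpoint subst (A : obj Q J) : obj P J :=
  match A with
  | Letter q => s q
  | One => One
  | Tens A B => (subst A ⊗ subst B)%obj
  | E i A => E i (subst A)
  end.

Fixpoint subst_arr A B (f : arr A B) : arr (subst A) (subst B) :=
  match f in arr A B return arr (subst A) (subst B) with
  | Id A => Id _
  | Assoc A B C => Assoc _ _ _
  | AssocV A B C => AssocV _ _ _
  | Lunit A => Lunit _
  | LunitV A => LunitV _
  | Runit A => Runit _
  | RunitV A => RunitV _
  | Sym A B => Sym _ _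
  | Psi i A B => Psi i _ _
  | Psi0 i => Psi0 i
  | Comp _ _ _ g f => subst_arr g ∘ subst_arr f
  | TensA _ _ _ _ f g => subst_arr f ⊗ subst_arr g
  | EA i _ _ f => EA i (subst_arr f)
  end.

Lemma subst_eq A B (f g : arr A B) : f ≈ g -> subst_arr f ≈ subst_arr g.
Proof.
elim=> {A B f g} /=; by move=> *; econstructor; eauto.
Qed.

End Substitution.

(** * The middle interchange *)
Section Interchange.
Variables P J : Type.
Implicit Types A B C D : obj P J.

(** This is the structure that makes [⊗] a monoidal functor in two variables.
Locked for the same reason as [swap]. *)
Definition mid A B C D : arr ((A ⊗ B) ⊗ (C ⊗ D)) ((A ⊗ C) ⊗ (B ⊗ D)) :=
  locked (AssocV A C (B ⊗ D) ∘ ((Id A ⊗ swap B C D) ∘ Assoc A B (C ⊗ D)))%arr.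

Lemma midE A B C D : mid A B C D =
  (AssocV A C (B ⊗ D) ∘ ((Id A ⊗ swap B C D) ∘ Assoc A B (C ⊗ D)))%arr.
Proof. by rewrite /mid -lock. Qed.

Lemma iso_mid A B C D : iso (mid A B C D).
Proof. by rewrite midE; auto 6 using iso_swap. Qed.

Lemma mid_nat A B C D A' B' C' D' (f : arr A A') (g : arr B B') (h : arr C C')
    (k : arr D D') :
  mid A' B' C' D' ∘ ((f ⊗ g) ⊗ (h ⊗ k)) ≈ ((f ⊗ h) ⊗ (g ⊗ k)) ∘ mid A B C D.
Proof.
rewrite !midE -!comp_assoc assoc_nat (chain (symmetry (tens_comp _ _ _ _))).
rewrite swap_nat comp_idl -{1}(comp_idr f) tens_comp -!comp_assoc.
by rewrite (chain (assocV_nat _ _ _)) -!comp_assoc.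
Qed.

Lemma G_mid1 A B C D i :
  G (mid A B C D) (lshift _ (lshift _ i)) = lshift _ (lshift _ i).
Proof. by rewrite midE !G_simp. Qed.

Lemma G_mid2 A B C D i :
  G (mid A B C D) (lshift _ (rshift _ i)) = rshift _ (lshift _ i).
Proof. by rewrite midE !(G_simp, G_swap1). Qed.

Lemma G_mid3 A B C D i :
  G (mid A B C D) (rshift _ (lshift _ i)) = lshift _ (rshift _ i).
Proof. by rewrite midE !(G_simp, G_swap2). Qed.

Lemma G_mid4 A B C D i :
  G (mid A B C D) (rshift _ (rshift _ i)) = rshift _ (rshift _ i).
Proof. by rewrite midE !(G_simp, G_swap3). Qed.

End Interchange.

Definition mid_simp := (G_mid1, G_mid2, G_mid3, G_mid4, G_simp).

Lemma subst_mid Q P J (s : Q -> obj P J) A B C D :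
  subst_arr s (mid A B C D) = mid (subst s A) (subst s B) (subst s C) (subst s D).
Proof. by rewrite !midE /= !swapE. Qed.

(** Closes the equality of the values of two arrows at an arbitrary occurrence in a
source given explicitly as a tensor of letters and [One], by locating that
occurrence. *)
Ltac letters :=
  let k := fresh "k" in move=> k;
  repeat match goal with
  | i : 'I_(Gobj (_ ⊗ _)) |- _ => case: (tens_ordP i) => {}i ->
  | i : 'I_(Gobj One) |- _ => by case: (i : 'I_0)
  end; by rewrite !mid_simp.

Section InterchangeCoherence.
Variables P J : Type.
Implicit Types A B C D : obj P J.

Notation "# n" := (Letter n : obj nat J) (at level 2).

(** Any equation between arrows that is an instance of symmetric monoidal coherence
holds for arbitrary objects [Ai], put in place of the letters [0], [1], ... *)
Lemma coh Ai (X Y : obj nat J) (f g : arr X Y) (s := nth (One : obj P J) Ai) :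
  noE Y -> (forall k : 'I_(Gobj X), G f k = G g k) -> subst_arr s f ≈ subst_arr s g.
Proof. by move=> nY Gfg; apply/subst_eq/noE_coherence => //; apply/ffunP. Qed.

(** The next four equations say that [⊗], with [mid] and [LunitV One], is a symmetric
monoidal functor; the last two relate [mid] to the insertion of units. *)
Lemma mid_assoc A1 A2 B1 B2 C1 C2 :
  (Assoc A1 B1 C1 ⊗ Assoc A2 B2 C2) ∘
    (mid (A1 ⊗ B1) (A2 ⊗ B2) C1 C2 ∘ (mid A1 A2 B1 B2 ⊗ Id (C1 ⊗ C2))) ≈
  mid A1 A2 (B1 ⊗ C1) (B2 ⊗ C2) ∘
    ((Id (A1 ⊗ A2) ⊗ mid B1 B2 C1 C2) ∘ Assoc (A1 ⊗ A2) (B1 ⊗ B2) (C1 ⊗ C2)).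
Proof.
have := @coh [:: A1; A2; B1; B2; C1; C2] _ _
  ((Assoc #0 #2 #4 ⊗ Assoc #1 #3 #5) ∘
    (mid (#0 ⊗ #2) (#1 ⊗ #3) #4 #5 ∘ (mid #0 #1 #2 #3 ⊗ Id (#4 ⊗ #5))))
  (mid #0 #1 (#2 ⊗ #4) (#3 ⊗ #5) ∘
    ((Id (#0 ⊗ #1) ⊗ mid #2 #3 #4 #5) ∘ Assoc (#0 ⊗ #1) (#2 ⊗ #3) (#4 ⊗ #5))).
by move=> /(_ ltac:(by repeat split) ltac:(letters)); rewrite /= !subst_mid.
Qed.

Lemma mid_sym A B C D :
  (Sym A C ⊗ Sym B D) ∘ mid A B C D ≈ mid C D A B ∘ Sym (A ⊗ B) (C ⊗ D).
Proof.
have := @coh [:: A; B; C; D] _ _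
  ((Sym #0 #2 ⊗ Sym #1 #3) ∘ mid #0 #1 #2 #3)
  (mid #2 #3 #0 #1 ∘ Sym (#0 ⊗ #1) (#2 ⊗ #3)).
by move=> /(_ ltac:(by repeat split) ltac:(letters)); rewrite /= !subst_mid.
Qed.

Lemma mid_lunit A B :
  (Lunit A ⊗ Lunit B) ∘ (mid One One A B ∘ (LunitV One ⊗ Id (A ⊗ B)))
  ≈ Lunit (A ⊗ B).
Proof.
have := @coh [:: A; B] _ _
  ((Lunit #0 ⊗ Lunit #1) ∘ (mid One One #0 #1 ∘ (LunitV One ⊗ Id (#0 ⊗ #1))))
  (Lunit (#0 ⊗ #1)).
by move=> /(_ ltac:(by repeat split) ltac:(letters)); rewrite /= !subst_mid.
Qed.

Lemma mid_runit A B :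
  (Runit A ⊗ Runit B) ∘ (mid A B One One ∘ (Id (A ⊗ B) ⊗ LunitV One))
  ≈ Runit (A ⊗ B).
Proof.
have := @coh [:: A; B] _ _
  ((Runit #0 ⊗ Runit #1) ∘ (mid #0 #1 One One ∘ (Id (#0 ⊗ #1) ⊗ LunitV One)))
  (Runit (#0 ⊗ #1)).
by move=> /(_ ltac:(by repeat split) ltac:(letters)); rewrite /= !subst_mid.
Qed.

Lemma mid_runitV A B :
  (Id (A ⊗ B) ⊗ Lunit One) ∘ (mid A One B One ∘ (RunitV A ⊗ RunitV B))
  ≈ RunitV (A ⊗ B).
Proof.
have := @coh [:: A; B] _ _
  ((Id (#0 ⊗ #1) ⊗ Lunit One) ∘ (mid #0 One #1 One ∘ (RunitV #0 ⊗ RunitV #1)))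
  (RunitV (#0 ⊗ #1)).
by move=> /(_ ltac:(by repeat split) ltac:(letters)); rewrite /= !subst_mid.
Qed.

Lemma mid_lunitV A B :
  (Lunit One ⊗ Id (A ⊗ B)) ∘ (mid One A One B ∘ (LunitV A ⊗ LunitV B))
  ≈ LunitV (A ⊗ B).
Proof.
have := @coh [:: A; B] _ _
  ((Lunit One ⊗ Id (#0 ⊗ #1)) ∘ (mid One #0 One #1 ∘ (LunitV #0 ⊗ LunitV #1)))
  (LunitV (#0 ⊗ #1)).
by move=> /(_ ltac:(by repeat split) ltac:(letters)); rewrite /= !subst_mid.
Qed.

End InterchangeCoherence.

(** * Arrows into a tensor *)
Section Splitting.
Variables P J : Type.
Implicit Types A B C D : obj P J.

(** A choice of a side for each outermost generator: [true] is the left one. *)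
Fixpoint mask A : Type :=
  match A with
  | Letter _ | E _ _ => bool
  | One => unit
  | Tens A B => (mask A * mask B)%type
  end.

(** The generators on side [c]; the others are replaced by [One]. *)
Fixpoint part (c : bool) A : mask A -> obj P J :=
  match A with
  | Letter p => fun b => if b == c then Letter p else One
  | One => fun _ => One
  | Tens A B => fun m => (part c m.1 ⊗ part c m.2)%obj
  | E i A => fun b => if b == c then E i A else One
  end.

Definition cut_atom A (b : bool) :
    arr A ((if b == true then A else One) ⊗ (if b == false then A else One)) :=
  match b with
  | true => RunitV A
  | false => LunitV A
  end.

Fixpoint cut A : forall m : mask A, arr A (part true m ⊗ part false m) :=
  match A with
  | Letter p => cut_atom (Letter p)
  | One => fun _ => LunitV One
  | Tens A B => fun m => mid _ _ _ _ ∘ (cut m.1 ⊗ cut m.2)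
  | E i A => cut_atom (E i A)
  end.

Lemma iso_cut A (m : mask A) : iso (cut m).
Proof. by elim: A m => [p|| A IA B IB|i A _] //=; try (by case); auto using iso_mid. Qed.

(** A mask on the target of an arrow pulls back to its source, and the arrow acts
separately on the two sides.  For the structural arrows this is the fact that [⊗]
is a symmetric monoidal functor.  The arrows [Psi], [Psi0] and [EA] have a target
with a single outermost generator, so that all of their source goes to one
side. *)
Lemma cut_nat A B (f : arr A B) (m : mask B) :
  exists (m' : mask A) (f1 : arr (part true m') (part true m))
         (f2 : arr (part false m') (part false m)),
    cut m ∘ f ≈ (f1 ⊗ f2) ∘ cut m'.
Proof.
elim: A B / f m.
- by move=> A m; exists m, (Id _), (Id _); rewrite tens_id comp_idl comp_idr.
- move=> A B C [a [b c]]; exists ((a, b), c), (Assoc _ _ _), (Assoc _ _ _) => /=.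
  rewrite tens_post_r tens_post_l -!comp_assoc.
  by rewrite (chain3 (mid_assoc _ _ _ _ _ _)) -!comp_assoc assoc_nat.
- move=> A B C [[a b] c]; exists (a, (b, c)), (AssocV _ _ _), (AssocV _ _ _).
  apply: (iso_epi (iso_assoc _ _ _)); rewrite -!comp_assoc assocK comp_idr /=.
  apply: (iso_mono (iso_tens (iso_assoc _ _ _) (iso_assoc _ _ _))).
  rewrite (chain (symmetry (tens_comp _ _ _ _))) !assocVK tens_id comp_idl.
  rewrite tens_post_r tens_post_l -!comp_assoc.
  by rewrite (chain3 (mid_assoc _ _ _ _ _ _)) -!comp_assoc assoc_nat.
- move=> A a; exists (tt, a), (Lunit _), (Lunit _) => /=.
  rewrite -lunit_nat -mid_lunit -!comp_assoc -tens_comp.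
  by rewrite comp_idl comp_idr.
- move=> A [[] a]; exists a, (LunitV _), (LunitV _).
  apply: (iso_epi (iso_lunit _)); rewrite -!comp_assoc lunitK comp_idr /=.
  apply: (iso_mono (iso_tens (iso_lunit _) (iso_lunit _))).
  rewrite (chain (symmetry (tens_comp _ _ _ _))) !lunitVK tens_id comp_idl.
  by rewrite -lunit_nat -mid_lunit -!comp_assoc -tens_comp comp_idl comp_idr.
- move=> A a; exists (a, tt), (Runit _), (Runit _) => /=.
  rewrite -runit_nat -mid_runit -!comp_assoc -tens_comp.
  by rewrite comp_idl comp_idr.
- move=> A [a []]; exists a, (RunitV _), (RunitV _).
  apply: (iso_epi (iso_runit _)); rewrite -!comp_assoc runitK comp_idr /=.
  apply: (iso_mono (iso_tens (iso_runit _) (iso_runit _))).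
  rewrite (chain (symmetry (tens_comp _ _ _ _))) !runitVK tens_id comp_idl.
  by rewrite -runit_nat -mid_runit -!comp_assoc -tens_comp comp_idl comp_idr.
- move=> A B [b a]; exists (a, b), (Sym _ _), (Sym _ _) => /=.
  by rewrite -comp_assoc -sym_nat comp_assoc -mid_sym -comp_assoc.
- move=> i A B [] /=.
  + exists (true, true), (Psi i A B), (Lunit One) => /=.
    rewrite -[X in _ ≈ (X ⊗ _) ∘ _]comp_idr -[X in _ ≈ (_ ⊗ X) ∘ _]comp_idl.
    rewrite tens_comp -comp_assoc mid_runitV.
    apply: (iso_mono (iso_runit _)); rewrite (chain (runitVK _)) comp_idl.
    by rewrite (chain (runit_nat _)) -comp_assoc runitVK comp_idr.
  + exists (false, false), (Lunit One), (Psi i A B) => /=.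
    rewrite -[X in _ ≈ (X ⊗ _) ∘ _]comp_idl -[X in _ ≈ (_ ⊗ X) ∘ _]comp_idr.
    rewrite tens_comp -comp_assoc mid_lunitV.
    apply: (iso_mono (iso_lunit _)); rewrite (chain (lunitVK _)) comp_idl.
    by rewrite (chain (lunit_nat _)) -comp_assoc lunitVK comp_idr.
- move=> i [] /=.
  + exists tt, (Psi0 i), (Id One) => /=; apply: (iso_mono (iso_runit _)).
    rewrite (chain (runitVK _)) comp_idl (chain (runit_nat _)) -lunit_runit.
    by rewrite -comp_assoc lunitVK comp_idr.
  + exists tt, (Id One), (Psi0 i) => /=; apply: (iso_mono (iso_lunit _)).
    rewrite (chain (lunitVK _)) comp_idl (chain (lunit_nat _)).
    by rewrite -comp_assoc lunitVK comp_idr.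
- move=> A B C g IHg f IHf m.
  have [m' [g1 [g2 eg]]] := IHg m; have [m'' [f1 [f2 ef]]] := IHf m'.
  exists m'', (g1 ∘ f1), (g2 ∘ f2).
  by rewrite comp_assoc eg -comp_assoc ef comp_assoc tens_comp.
- move=> A B C D f IHf g IHg [mb md].
  have [ma [f1 [f2 ef]]] := IHf mb; have [mc [g1 [g2 eg]]] := IHg md.
  exists (ma, mc), (f1 ⊗ g1), (f2 ⊗ g2) => /=.
  by rewrite -comp_assoc -tens_comp ef eg tens_comp comp_assoc mid_nat -comp_assoc.
- move=> i A B f _ [] /=.
  + exists true, (EA i f), (Id One) => /=.
    apply: (iso_mono (iso_runit _)); rewrite (chain (runitVK _)) comp_idl.
    by rewrite (chain (runit_nat _)) -comp_assoc runitVK comp_idr.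
  + exists false, (Id One), (EA i f) => /=.
    apply: (iso_mono (iso_lunit _)); rewrite (chain (lunitVK _)) comp_idl.
    by rewrite (chain (lunit_nat _)) -comp_assoc lunitVK comp_idr.
Qed.

Definition left_of A B (k : 'I_(Gobj (A ⊗ B))) : bool := k < Gobj A.

Lemma left_l A B i : @left_of A B (lshift _ i).
Proof. exact: (ltn_ord i). Qed.

Lemma left_r A B i : @left_of A B (rshift _ i) = false.
Proof. by apply/negbTE; rewrite -leqNgt leq_addr. Qed.

Lemma left_tens A B C D (f : arr A B) (g : arr C D) k :
  left_of (G (f ⊗ g) k) = left_of k.
Proof. by case: (tens_ordP k) => i ->; rewrite !G_simp ?left_l ?left_r. Qed.

Lemma left_mid_l A B C D (k : 'I_(Gobj (A ⊗ B))) :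
  left_of (G (mid A B C D) (lshift _ k)) = left_of k.
Proof. by case: (tens_ordP k) => i ->; rewrite !mid_simp ?left_l ?left_r. Qed.

Lemma left_mid_r A B C D (k : 'I_(Gobj (C ⊗ D))) :
  left_of (G (mid A B C D) (rshift _ k)) = left_of k.
Proof. by case: (tens_ordP k) => i ->; rewrite !mid_simp ?left_l ?left_r. Qed.

Lemma cutT A B (m : mask (A ⊗ B)) :
  cut m = (mid _ _ _ _ ∘ (cut m.1 ⊗ cut m.2))%arr.
Proof. by []. Qed.

Lemma left_cut_atom A b k : left_of (G (cut_atom A b) k) = b.
Proof. by case: b => /=; rewrite -/(G _) ?G_runitV ?G_lunitV ?left_l ?left_r. Qed.

(** The mask can be read off [G (cut m)]: it tells which generators go left. *)
Lemma cut_inj A (m m' : mask A) :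
  (forall k, left_of (G (cut m) k) = left_of (G (cut m') k)) -> m = m'.
Proof.
elim: A m m' => [p|| A IA B IB|i A _].
- by move=> b b' /(_ ord0); rewrite /= !left_cut_atom.
- by move=> [] [].
- move=> [a b] [a' b'] e; congr pair.
    apply: IA => k; have := e (lshift _ k).
    by rewrite !cutT !G_comp !G_tensl !left_mid_l.
  apply: IB => k; have := e (rshift _ k).
  by rewrite !cutT !G_comp !G_tensr !left_mid_r.
- by move=> b b' /(_ ord0); rewrite /= !left_cut_atom.
Qed.

Fixpoint const_mask (b : bool) A : mask A :=
  match A with
  | Letter _ | E _ _ => b
  | One => tt
  | Tens A B => (const_mask b A, const_mask b B)
  end.

Lemma part_const b A :
  (exists u : arr (part b (const_mask b A)) A, iso u) /\
  (exists u : arr (part (~~ b) (const_mask b A)) One, iso u).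
Proof.
elim: A => [p|| A [[u iu] [v iv]] B [[u' iu'] [v' iv']]|i A _] /=.
- by split; case: b => /=; eexists; apply: iso_id.
- by split; eexists; apply: iso_id.
- split; first by exists (u ⊗ u'); auto.
  by exists (Lunit One ∘ (v ⊗ v')); auto.
- by split; case: b => /=; eexists; apply: iso_id.
Qed.

(** The arrow [w] cuts [B1 ⊗ B2] along the mask that is [true] on [B1] and [false] on
[B2], and then deletes the unit objects that were left in place of generators.  It
is isomorphic to the identity, but all that matters is that it is invertible and
does not depend on [f]. *)
Lemma tens_target B1 B2 : exists w : arr (B1 ⊗ B2) (B1 ⊗ B2), iso w /\
  forall A (f : arr A (B1 ⊗ B2)), exists (m : mask A)
    (f1 : arr (part true m) B1) (f2 : arr (part false m) B2),
    w ∘ f ≈ (f1 ⊗ f2) ∘ cut m.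
Proof.
have [[u1 iu1] [v1 iv1]] := part_const true B1.
have [[u2 iu2] [v2 iv2]] := part_const false B2.
pose m : mask (B1 ⊗ B2) := (const_mask true B1, const_mask false B2).
pose u : arr (part true m) B1 := (Runit B1 ∘ (u1 ⊗ v2))%arr.
pose v : arr (part false m) B2 := (Lunit B2 ∘ (v1 ⊗ u2))%arr.
exists ((u ⊗ v) ∘ cut m); split.
  by apply: iso_comp (iso_cut _); rewrite /u /v; auto.
move=> A f; have [m' [f1 [f2 e]]] := cut_nat f m.
exists m', (u ∘ f1), (v ∘ f2).
by rewrite -comp_assoc e comp_assoc tens_comp.
Qed.

End Splitting.

(** * Arrows into the image of a functor *)
Section Gathering.
Variables P J : Type.
Implicit Types A B C D : obj P J.

(** All outermost generators are the functor [i]. *)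
Fixpoint allE (i : J) A : Type :=
  match A with
  | Letter _ => void
  | One => unit
  | Tens A B => (allE i A * allE i B)%type
  | E j _ => j = i
  end.

Fixpoint strip i A : allE i A -> obj P J :=
  match A with
  | Letter _ => fun h => match h with end
  | One => fun _ => One
  | Tens A B => fun h => (strip h.1 ⊗ strip h.2)%obj
  | E _ A => fun _ => A
  end.

(** The iterated [Psi i], with [Psi0 i] for the empty tensor. *)
Fixpoint gather i A : forall h : allE i A, arr A (E i (strip h)) :=
  match A with
  | Letter _ => fun h => match h with end
  | One => fun _ => Psi0 i
  | Tens A B => fun h => Psi i (strip h.1) (strip h.2) ∘ (gather h.1 ⊗ gather h.2)
  | E j A => fun e => match e in _ = k return arr (E j A) (E k A) with
                      | erefl => Id (E j A)
                      end
  end.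

Lemma allE_unique i A (h h' : allE i A) : h = h'.
Proof.
elim: A h h' => [p||A IA B IB|j A _] //=; first by move=> [] [].
  by move=> [a b] [a' b']; rewrite (IA a a') (IB b b').
by move=> h h'; apply: proof_irrelevance.
Qed.

(** An arrow sends outermost generators to outermost generators of the same kind, so
that those of the source are again [i].  The two sides agree on each generating
arrow by the corresponding axiom of linear endofunctors:
[psi_assoc], [psi_lunit], [psi_runit], [psi_sym] and [psi_nat]; for [Psi], [Psi0]
and [EA] they agree by definition of [gather]. *)
Lemma gather_nat i A B (f : arr A B) (h : allE i B) :
  exists (h' : allE i A) (f' : arr (strip h') (strip h)),
    gather h ∘ f ≈ EA i f' ∘ gather h'.
Proof.
elim: A B / f h.
- by move=> A h; exists h, (Id _); rewrite E_id comp_idl comp_idr.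
- move=> A B C [a [b c]]; exists ((a, b), c), (Assoc _ _ _) => /=.
  rewrite tens_post_r tens_post_l -!comp_assoc -assoc_nat.
  have := psi_assoc i (strip a) (strip b) (strip c); rewrite -!comp_assoc => e.
  by rewrite (chain3 e) -!comp_assoc.
- move=> A B C [[a b] c]; exists (a, (b, c)), (AssocV _ _ _) => /=.
  apply: (iso_epi (iso_assoc _ _ _)); rewrite -!comp_assoc assocK comp_idr.
  rewrite tens_post_r tens_post_l -!comp_assoc -assoc_nat.
  have := psi_assoc i (strip a) (strip b) (strip c); rewrite -!comp_assoc => e.
  rewrite (chain3 (symmetry e)) -!comp_assoc (chain (symmetry (E_comp _ _ _))).
  by rewrite assocK E_id comp_idl.
- move=> A a; exists (tt, a), (Lunit _) => /=.
  rewrite -lunit_nat.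
  have := psi_lunit i (strip a); rewrite -!comp_assoc => <-.
  by rewrite -!comp_assoc -tens_comp comp_idl comp_idr.
- move=> A [[] a]; exists a, (LunitV _) => /=.
  apply: (iso_epi (iso_lunit _)); rewrite -!comp_assoc lunitK comp_idr -lunit_nat.
  have := psi_lunit i (strip a); rewrite -!comp_assoc => <-.
  rewrite -!comp_assoc (chain (symmetry (E_comp _ _ _))) lunitK E_id comp_idl.
  by rewrite -tens_comp comp_idl comp_idr.
- move=> A a; exists (a, tt), (Runit _) => /=.
  rewrite -runit_nat.
  have := psi_runit i (strip a); rewrite -!comp_assoc => <-.
  by rewrite -!comp_assoc -tens_comp comp_idl comp_idr.
- move=> A [a []]; exists a, (RunitV _) => /=.
  apply: (iso_epi (iso_runit _)); rewrite -!comp_assoc runitK comp_idr -runit_nat.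
  have := psi_runit i (strip a); rewrite -!comp_assoc => <-.
  rewrite -!comp_assoc (chain (symmetry (E_comp _ _ _))) runitK E_id comp_idl.
  by rewrite -tens_comp comp_idl comp_idr.
- move=> A B [b a]; exists (a, b), (Sym _ _) => /=.
  by rewrite -comp_assoc -sym_nat comp_assoc -psi_sym -comp_assoc.
- move=> j A B /= h; case: _ / h.
  exists (erefl, erefl), (Id _) => /=.
  by rewrite tens_id comp_idr comp_idl E_id comp_idl.
- move=> j /= h; case: _ / h.
  by exists tt, (Id _); rewrite /= comp_idl E_id comp_idl.
- move=> A B C g IHg f IHf h.
  have [h' [g' eg]] := IHg h; have [h'' [f' ef]] := IHf h'.
  exists h'', (g' ∘ f').
  by rewrite comp_assoc eg -comp_assoc ef comp_assoc E_comp.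
- move=> A B C D f IHf g IHg [hb hd].
  have [ha [f' ef]] := IHf hb; have [hc [g' eg]] := IHg hd.
  exists (ha, hc), (f' ⊗ g') => /=.
  by rewrite -comp_assoc -tens_comp ef eg tens_comp comp_assoc -psi_nat -comp_assoc.
- move=> j A B f _ /= h; case: _ / h.
  by exists erefl, f; rewrite /= comp_idl comp_idr.
Qed.

Lemma G_EAr i A B (f : arr A B) k : G (EA i f) (rshift 1 k) = rshift 1 (G f k).
Proof. exact: fun_tensr. Qed.

Lemma G_psil i A B k :
  G (Psi i A B) (lshift _ (rshift 1 k)) = rshift 1 (lshift _ k).
Proof. by rewrite ffunE (unsplitK (inl _)) (unsplitK (inr _)). Qed.

Lemma G_psir i A B k :
  G (Psi i A B) (rshift _ (rshift 1 k)) = rshift 1 (rshift _ k).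
Proof. by rewrite ffunE (unsplitK (inr _)) (unsplitK (inr _)). Qed.

Lemma gatherT i A B (h : allE i (A ⊗ B)) :
  gather h = (Psi i (strip h.1) (strip h.2) ∘ (gather h.1 ⊗ gather h.2))%arr.
Proof. by []. Qed.

(** All elements other than the root [0] are reached.  The root is not when the
source has no generators at all, as [G (Psi0 i)] is the empty function. *)
Lemma gather_surj i A (h : allE i A) k : exists j, G (gather h) j = rshift 1 k.
Proof.
elim: A h k => [p||A IA B IB|j A _]; [by case | by move=> [] [] | |].
- move=> [a b] k; case: (tens_ordP (k : 'I_(Gobj (strip a ⊗ strip b)))) => l ->.
  + have [j ej] := IA a l; exists (lshift _ j).
    by rewrite gatherT G_comp G_tensl ej G_psil.
  + have [j ej] := IB b l; exists (rshift _ j).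
    by rewrite gatherT G_comp G_tensr ej G_psir.
- by move=> h; destruct h => k; exists (rshift 1 k); apply: G_id.
Qed.

End Gathering.

(** * Faithfulness *)
Theorem mainTheorem5 (P J : Type) (A B : obj P J) (f g : arr A B) :
  G f = G g -> f ≈ g.
Proof.
elim: B => [p||B1 IH1 B2 IH2|i B IH] in A f g * => Gfg.
- exact: (noE_coherence (B := Letter p) tt).
- exact: (noE_coherence (B := One) tt).
- have [w [iw decomp]] := tens_target B1 B2.
  have [m [f1 [f2 ef]]] := decomp _ f; have [m' [g1 [g2 eg]]] := decomp _ g.
  have Gf k : G (f1 ⊗ f2) (G (cut m) k) = G w (G f k).
    by rewrite -!G_comp (G_arr_eq ef).
  have Gg k : G (g1 ⊗ g2) (G (cut m') k) = G w (G f k).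
    by rewrite Gfg -!G_comp (G_arr_eq eg).
  have em : m = m'.
    by apply: cut_inj => k; rewrite -(left_tens f1 f2) Gf -Gg left_tens.
  case: _ / em in g1 g2 eg Gg.
  apply: (iso_mono iw); rewrite ef eg; apply: cong_comp => //.
  apply: cong_tens.
    apply: IH1; apply/ffunP => i.
    have [j ej] := iso_surj (iso_cut m) (lshift _ i).
    by have := Gf j; rewrite -Gg ej !G_tensl => /lshift_inj.
  apply: IH2; apply/ffunP => i.
  have [j ej] := iso_surj (iso_cut m) (rshift _ i).
  by have := Gf j; rewrite -Gg ej !G_tensr => /rshift_inj.
- pose h0 : allE i (E i B) := erefl i.
  have [h [f' ef]] := gather_nat f h0; have [h' [g' eg]] := gather_nat g h0.
  case: _ / (allE_unique h h') in g' eg.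
  rewrite /= !comp_idl in ef eg; rewrite ef eg; apply: cong_comp => //.
  apply: cong_E; apply: IH; apply/ffunP => k.
  have [j ej] := gather_surj k.
  have : G (EA i f') (rshift 1 k) = G (EA i g') (rshift 1 k).
    by rewrite -ej -!G_comp -(G_arr_eq ef) Gfg (G_arr_eq eg).
  by rewrite !G_EAr => /rshift_inj.
Qed.
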